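(* Let $h\in\mathbb{N}$ and let $G(p)=\sum_{k=0}^h p^k\Gamma_k$ with $\Gamma_k\in\mathbb{R}^{(n+n_{\mathrm o})\times(n+n_{\mathrm i})}$ depend polynomially on the scalar parameter $p$. Let $\mathbb{L},\mathbb{L}_s\in\mathbb{R}^{M(n+n_{\mathrm o})\times N(n+n_{\mathrm i})}$ be the Loewner and shifted Loewner matrices of $G$ associated with the sample points $\pi_1,\dots,\pi_M$ and $\phi_1,\dots,\phi_N$. Then $$\operatorname{rank}(\mathbb{L})\le\sum_{k=0}^h\operatorname{rank}(\Gamma_k)\operatorname{rank}(\Xi_k),\qquad \operatorname{rank}(\mathbb{L}_s)\le\sum_{k=0}^h\operatorname{rank}(\Gamma_k)\operatorname{rank}(\Xi_{k+1}),$$ where $\Xi_k\in\mathbb{R}^{M(n+n_{\mathrm o})\times N(n+n_{\mathrm i})}$ is the block matrix with $(i,j)$-th block $$\{\Xi_k\}_{i,j}=\left(\frac{\pi_i^k-\phi_j^k}{\pi_i-\phi_j}\right)\mathbb{1}_{n+n_{\mathrm o},\,n+n_{\mathrm i}}.$$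
   Context: The sample points $\pi_1,\dots,\pi_M,\phi_1,\dots,\phi_N\in\mathbb{R}$ ($M,N\ge1$) are pairwise distinct; in particular $\pi_i\ne\phi_j$ for all $i,j$. The Loewner matrix $\mathbb{L}$ and shifted Loewner matrix $\mathbb{L}_s$ are the block matrices whose $(i,j)$-th blocks, of size $(n+n_{\mathrm o})\times(n+n_{\mathrm i})$ ($1\le i\le M$, $1\le j\le N$), are $$\{\mathbb{L}\}_{i,j}=\frac{G(\pi_i)-G(\phi_j)}{\pi_i-\phi_j},\qquad \{\mathbb{L}_s\}_{i,j}=\frac{\pi_iG(\pi_i)-\phi_jG(\phi_j)}{\pi_i-\phi_j}.$$ $\mathbb{1}_{a,b}$ is the $a\times b$ matrix of ones. Here $n,n_{\mathrm i},n_{\mathrm o}$ are the state, input and output dimensions of an underlying parametric system. The convention $x^0=1$ is used, so $\Xi_0=0$. *)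

(* Defs.v *)
From HB Require Import structures.
From mathcomp Require Import all_boot all_order all_algebra.
From mathcomp Require Import reals.

Set Implicit Arguments.
Unset Strict Implicit.
Unset Printing Implicit Defensive.

Import GRing.Theory.
Local Open Scope ring_scope.

(* In all block matrices below the numbers of rows and columns appear as the
   constant sums \sum_(i < M) a and \sum_(j < N) b, i.e., M * a and N * b: this
   is the form in which \mxblock records the block structure. *)

Definition loewner (R : realType) (M N a b : nat)
    (G : R -> 'M[R]_(a, b)) (pi : 'I_M -> R) (phi : 'I_N -> R) :
    'M[R]_(\sum_(i < M) a, \sum_(j < N) b) :=
  \mxblock_(i < M, j < N) ((pi i - phi j)^-1 *: (G (pi i) - G (phi j))).

Definition shifted_loewner (R : realType) (M N a b : nat)
    (G : R -> 'M[R]_(a, b)) (pi : 'I_M -> R) (phi : 'I_N -> R) :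
    'M[R]_(\sum_(i < M) a, \sum_(j < N) b) :=
  \mxblock_(i < M, j < N)
    ((pi i - phi j)^-1 *: (pi i *: G (pi i) - phi j *: G (phi j))).

Definition Xi (R : realType) (M N a b : nat)
    (pi : 'I_M -> R) (phi : 'I_N -> R) (k : nat) :
    'M[R]_(\sum_(i < M) a, \sum_(j < N) b) :=
  \mxblock_(i < M, j < N)
    (((pi i ^+ k - phi j ^+ k) / (pi i - phi j)) *: (const_mx 1 : 'M[R]_(a, b))).

Arguments Xi {R M N} a b pi phi k.

(* Main.v *)
(** Entrywise linearity in G writes each Loewner matrix as a sum of Kronecker
    products K_k ⊗ Γ_k, where K_k holds the scalar divided differences of the
    k-th power (of the (k+1)-st power for the shifted matrix). Since rank is
    subadditive and a Kronecker product satisfies rank (K ⊗ A) <= rank K rank A,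
    it remains to see that K_k is a submatrix of Ξ_k = K_k ⊗ 1, so that
    rank K_k <= rank Ξ_k, as soon as the blocks are nonempty. *)

Require Import Defs.
From HB Require Import structures.
From mathcomp Require Import all_boot all_order all_algebra.
From mathcomp Require Import reals.

Set Implicit Arguments.
Unset Strict Implicit.
Unset Printing Implicit Defensive.

Import GRing.Theory.
Local Open Scope ring_scope.

(** Selecting rows and columns of [A *m 1%:M] splits into selected rows of [A] times selected
    columns of the identity, and selected rows stay in the row space of [A]. *)
Lemma mxrank_mxsub (F : fieldType) (m n m' n' : nat)
    (f : 'I_m' -> 'I_m) (g : 'I_n' -> 'I_n) (A : 'M[F]_(m, n)) :
  (\rank (mxsub f g A) <= \rank A)%N.
Proof.
rewrite -[A]mulmx1 -[X in (\rank X <= _)%N]/(mxsub f g (A *m 1%:M)) mxsub_mul.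
apply: leq_trans (mxrankM_maxl _ _) _; rewrite mulmx1.
exact: mxrankS (rowsub_sub _ _).
Qed.

Lemma mxrank_sum (F : fieldType) (m n : nat) (I : finType)
    (A : I -> 'M[F]_(m, n)) :
  (\rank (\sum_i A i)%R <= \sum_i \rank (A i))%N.
Proof.
elim/big_rec2: _ => [|i r B _ leBr]; first by rewrite mxrank0.
by apply: leq_trans (mxrank_add _ _) _; rewrite leq_add2l.
Qed.

Lemma mxrank_kronecker (F : fieldType) (M N a b : nat)
    (C : 'M[F]_(M, N)) (A : 'M[F]_(a, b)) :
  (\rank (\mxblock_(i < M, j < N) (C i j *: A)) <= \rank A * \rank C)%N.
Proof.
(* The mixed-product rule factors C ⊗ A through dimension rank C * rank A. *)
have -> : \mxblock_(i < M, j < N) (C i j *: A) =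
    \mxblock_(i < M, k < \rank C) (col_base C i k *: col_base A) *m
    \mxblock_(k < \rank C, j < N) (row_base C k j *: row_base A).
  rewrite mul_mxblock; apply: eq_mxblock => i j.
  rewrite -{1}(mulmx_base C) mxE scaler_suml; apply: eq_bigr => k _.
  by rewrite -scalemxAl -scalemxAr mulmx_base scalerA.
apply: leq_trans (mulmx_max_rank _ _) _.
by rewrite sum_nat_const card_ord mulnC.
Qed.

Lemma mxrank_kronecker_ones (F : fieldType) (M N a b : nat)
    (C : 'I_M -> 'I_N -> F) (A : 'M[F]_(a, b)) :
  (\rank (\mxblock_(i < M, j < N) (C i j *: A)) <=
   \rank A *
   \rank (\mxblock_(i < M, j < N) (C i j *: (const_mx 1%R : 'M[F]_(a, b)))))%N.
Proof.
have [-> | A_neq0] := eqVneq A 0.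
  have -> : \mxblock_(i < M, j < N) (C i j *: (0 : 'M[F]_(a, b))) = 0.
    by rewrite -mxblock0; apply: eq_mxblock => i j; rewrite scaler0.
  by rewrite !mxrank0 ?leq0n.
(* A nonzero [A] has no empty dimension, so every block of ones has an entry at [ord0], [ord0]. *)
case: a b A A_neq0 => [|a] [|b] A;
  rewrite ?flatmx0 ?thinmx0 ?eqxx // => _.
set X := (X in (_ <= _ * \rank X)%N).
have -> : \mxblock_(i < M, j < N) (C i j *: A) =
    \mxblock_(i < M, j < N) ((\matrix_(i, j) C i j) i j *: A).
  by apply: eq_mxblock => i j; rewrite mxE.
apply: leq_trans (mxrank_kronecker _ _) _; rewrite leq_mul2l.
(* The top-left entry of block (i, j) of [X] is [C i j * 1]. *)
have -> : \matrix_(i, j) C i j =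
    mxsub (fun i => tagnat.Rank i ord0) (fun j => tagnat.Rank j ord0) X.
  apply/matrixP => i j; rewrite mxE.
  have /matrixP/(_ ord0 ord0) :=
    mxblockK (fun i j => C i j *: (const_mx 1 : 'M[F]_(a.+1, b.+1))) i j.
  by rewrite [in RHS]mxE [in RHS]mxE mulr1 => <-; rewrite [LHS]mxE [RHS]mxE.
by rewrite mxrank_mxsub orbT.
Qed.

(** Common form of both bounds, which differ only in the scalars [C]; what remains for each is the
    blockwise identity [B_def]. *)
Lemma mxrank_sum_kronecker (F : fieldType) (M N a b : nat) (I : finType)
    (C : I -> 'I_M -> 'I_N -> F) (A : I -> 'M[F]_(a, b))
    (B : 'I_M -> 'I_N -> 'M[F]_(a, b))
    (B_def : forall i j, B i j = \sum_k C k i j *: A k) :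
  (\rank (\mxblock_(i < M, j < N) B i j) <=
   \sum_k \rank (A k) * \rank
     (\mxblock_(i < M, j < N) (C k i j *: (const_mx 1%R : 'M[F]_(a, b)))))%N.
Proof.
rewrite (eq_mxblock B_def) mxblock_sum.
apply: leq_trans (mxrank_sum _) _.
by apply: leq_sum => k _; apply: mxrank_kronecker_ones.
Qed.

Theorem theorem4p3 (R : realType) (n ni no : nat) (M N : nat)
  (M_gt0 : (0 < M)%N) (N_gt0 : (0 < N)%N)
  (pi : 'I_M -> R) (phi : 'I_N -> R)
  (pi_inj : injective pi) (phi_inj : injective phi)
  (pi_neq_phi : forall i j, pi i != phi j)
  (h : nat) (Gamma : 'I_h.+1 -> 'M[R]_(n + no, n + ni))
  (G : R -> 'M[R]_(n + no, n + ni))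
  (G_def : forall p : R, G p = \sum_(k < h.+1) p ^+ k *: Gamma k) :
  (\rank (loewner G pi phi) <=
     \sum_(k < h.+1) \rank (Gamma k) * \rank (Xi (n + no) (n + ni) pi phi k))%N
  /\
  (\rank (shifted_loewner G pi phi) <=
     \sum_(k < h.+1)
       \rank (Gamma k) * \rank (Xi (n + no) (n + ni) pi phi k.+1))%N.
Proof.
split; apply: mxrank_sum_kronecker => i j; rewrite !G_def.
  rewrite -sumrB scaler_sumr; apply: eq_bigr => k _.
  by rewrite -scalerBl scalerA mulrC.
(* The extra factor p in p G(p) turns p^k into p^(k+1), whence the index [k.+1] of [Xi]. *)
rewrite !scaler_sumr -sumrB scaler_sumr; apply: eq_bigr => k _.
by rewrite !scalerA -!exprS -scalerBl scalerA mulrC.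
Qed.
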